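(* Let $R$ be an associative ring with unity $1$ and let $a,b,c,v,w\in R$ with at least one of $v$, $w$ invertible. If $a$ has a hybrid $(v,w)$-weighted $(b,c)$-inverse, then: (i) $rann(vawb)=rann(b)$. (ii) If $rann(b)=rann(c)$, then $rann(vawbs)=rann(vawb)$ whenever $s\in R$ satisfies $vawb=(vawb)^2s$.
   Context: For $x\in R$: $xR=\{xr: r\in R\}$ and $rann(x)=\{z\in R: xz=0\}$. An element $y\in R$ is the hybrid $(v,w)$-weighted $(b,c)$-inverse of $a$ if $yvawy=y$, $yvR=bR$ and $rann(c)=rann(wy)$. *)

(* Defs.v *)
From mathcomp Require Export all_boot all_algebra.
From mathcomp Require Export classical_sets.

Set Implicit Arguments.
Unset Strict Implicit.
Unset Printing Implicit Defensive.

Import GRing.Theory.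
Local Open Scope classical_set_scope.
Local Open Scope ring_scope.

Section HybridInverse.
Variable R : pzRingType.
Implicit Types a b c v w x y : R.

Definition right_ideal x : set R := [set x * r | r in [set: R]].

Definition rann x : set R := [set z | x * z = 0].

(* GRing.unit is only available on a unitRingType, whereas R is an arbitrary
   ring here. *)
Definition invertible x : Prop := exists x', x' * x = 1 /\ x * x' = 1.

Definition is_weighted_hybrid_inverse v w b c a y : Prop :=
  [/\ y * v * a * w * y = y,
      right_ideal (y * v) = right_ideal b
    & rann c = rann (w * y)].

Definition has_weighted_hybrid_inverse v w b c a : Prop :=
  exists y, is_weighted_hybrid_inverse v w b c a y.

End HybridInverse.

(* Main.v *)
(** Write [p = v a w b].  Since [b] lies in [y v R] and [y v a w y = y], left
    multiplication by [y] recovers [b] from [p], that is [y p = b]; this gives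
    [rann p = rann b].  If moreover [rann b = rann c = rann (w y)] and
    [p = p^2 s], then [1 - p s] is annihilated by [p], hence by [w y], so that
    [w y = w y p s = w b s] and [p s = v a w y]. *)
Require Import Defs.
From mathcomp Require Import all_boot all_algebra classical_sets.

Import GRing.Theory.
Local Open Scope ring_scope.

Lemma mem_rann (R : pzRingType) (x z : R) : rann x z <-> x * z = 0.
Proof. by []. Qed.

Lemma weighted_hybrid_inverse_mull {R : pzRingType} {v w b c a y : R} :
  is_weighted_hybrid_inverse v w b c a y -> y * (v * a * w * b) = b.
Proof.
case=> yvawy yvR _.
(* Since [R] has a unity, [b = b * 1] lies in [bR = yvR], so [b = y * v * r] for some [r]. *)
have [r _ <-] : right_ideal (y * v) b by rewrite yvR; exists 1; rewrite ?mulr1.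
by rewrite !mulrA yvawy.
Qed.

Lemma rann_vawb {R : pzRingType} {v w b c a y : R} :
  is_weighted_hybrid_inverse v w b c a y -> rann (v * a * w * b) = rann b.
Proof.
move=> /weighted_hybrid_inverse_mull yp; apply/seteqP; split=> z.
  by move=> /mem_rann pz; apply/mem_rann; rewrite -yp -mulrA pz mulr0.
by move=> /mem_rann bz; apply/mem_rann; rewrite -mulrA bz mulr0.
Qed.

Theorem theorem4p5 (R : pzRingType) (a b c v w : R)
    (vw_inv : invertible v \/ invertible w)
    (a_hyb : has_weighted_hybrid_inverse v w b c a) :
  rann (v * a * w * b) = rann b /\
  (rann b = rann c ->
   forall s : R, v * a * w * b = (v * a * w * b) ^+ 2 * s ->
     rann (v * a * w * b * s) = rann (v * a * w * b)).
Proof.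
case: a_hyb => y Hy; have rannp := rann_vawb Hy.
split=> // rannbc s ps.
have yp := weighted_hybrid_inverse_mull Hy.
have rannwy : rann (v * a * w * b) = rann (w * y).
  by case: Hy => _ _ <-; rewrite rannp.
have wbs : w * b * s = w * y.
  have : rann (w * y) (v * a * w * b * s - 1).
    rewrite -rannwy; apply/mem_rann.
    by rewrite mulrBr mulr1 mulrA -expr2 -ps subrr.
  move=> /mem_rann/eqP; rewrite mulrBr mulr1 subr_eq0 => /eqP <-.
  by rewrite [RHS]mulrA -(mulrA w y) yp.
apply/seteqP; split=> z.
  (* If [p * s * z = 0], then [p * z = p ^+ 2 * s * z = p * (p * s * z) = 0]. *)
  by move=> /mem_rann psz; apply/mem_rann; rewrite ps expr2 -mulrA -mulrA [X in _ * X]mulrA psz mulr0.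
(* Conversely, [p * z = 0] means [w * y * z = 0], and [p * s * z = v * a * (w * b * s) * z = v * a *
   (w * y * z)]. *)
rewrite {1}rannwy => /mem_rann wyz; apply/mem_rann.
by rewrite -(mulrA (v * a) w b) -(mulrA (v * a)) wbs -(mulrA (v * a)) wyz mulr0.
Qed.
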